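(* Let $A\in\mathbb C^{6\times6}$ be a rank-three partial isometry with $\operatorname{def}A\ge2$. Then $C(A)$ contains a (non-degenerate) circle if and only if $A$ is circularly equivalent to a matrix $$M=\begin{bmatrix}0&0&0&1&0&0\\0&0&0&0&b&0\\0&0&0&0&c&e\\0&0&0&0&d&f\\0&0&0&0&0&g\\0&0&0&0&0&h\end{bmatrix}$$ with $b,c,d,e,h\ge0$, $f,g\in\mathbb R$, $f\ge0$ if $ce=0$ and $f\le0$ otherwise, and $c=0$ whenever $e=0$, for which the system $p(\rho)=0,\ q(\rho)=0$ has solutions $\rho_i\in(0,1)$, where $$p(\rho)=h\rho^2-\tfrac12h\rho+\tfrac1{16}\bigl((b^2+c^2)h-ceg\bigr),$$ $$q(\rho)=\rho^3-\tfrac14(3-h^2)\rho^2+\tfrac1{16}(c^2+b^2+e^2+1-h^2)\rho-\tfrac1{64}b^2e^2 .$$ If this is the case, the circles contained in $C(A)$ are centered at the origin and have the radii $r_i=\sqrt{\rho_i}$.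
   Context: A matrix $A$ is a partial isometry if $\|Ax\|=\|x\|$ for all $x\perp\ker A$. $\operatorname{def}A$ is the defect of the eigenvalue $0$ of $A$: its algebraic multiplicity minus its geometric multiplicity. Matrices $A$ and $B$ are circularly equivalent ($A\sim B$) if $B=e^{i\theta}UAU^*$ for some unitary $U$ and real $\theta$. Put $\operatorname{Re}X=(X+X^* )/2$. The Kippenhahn polynomial of $A\in\mathbb C^{n\times n}$ is $P_A(\lambda,\theta)=\det(\operatorname{Re}(e^{i\theta}A)-\lambda I)$. With $\lambda_1(\theta),\dots,\lambda_n(\theta)$ its roots in $\lambda$, the Kippenhahn curve $C(A)$ is the envelope of the family of lines $\{e^{-i\theta}(\lambda_j(\theta)+i\mathbb R):\theta\in(-\pi,\pi],\ j=1,\dots,n\}$. $\mathcal C_{a,r}$ is the circle of radius $r>0$ centered at $a$, and $\mathcal C_r=\mathcal C_{0,r}$. The containment $C(A)\supset\mathcal C_r$ holds if and only if, for all $\theta$, $P_A(\lambda,\theta)$ is divisible by $\lambda^2-r^2$ as a polynomial in $\lambda$; and $C(A)\supset\mathcal C_{a,r}$ if and only if $C(A-aI)\supset\mathcal C_r$ (these may be taken as definitions). Since $A$ is a rank-three partial isometry, the last three columns of $M$ are automatically orthonormal: $b^2+c^2+d^2=1$, $e^2+f^2+g^2+h^2=1$, $ce+df=0$. *)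

(* Defs.v *)
From HB Require Import structures.
From mathcomp Require Import all_boot all_order all_algebra.
From mathcomp Require Import complex.
From mathcomp Require Import reals trigo.

Set Implicit Arguments.
Unset Strict Implicit.
Unset Printing Implicit Defensive.

Import Order.TTheory GRing.Theory Num.Theory.
Local Open Scope ring_scope.
Local Open Scope complex_scope.
Local Open Scope sesquilinear_scope.

Section Kippenhahn.
Variable R : realType.

Definition expi (theta : R) : R[i] := cos theta +i* sin theta.

(* Euclidean norm; the norm that MathComp-Analysis puts on matrices is the
   maximum of the entries. *)
Definition euclid_norm n (x : 'cV[R[i]]_n) : R[i] :=
  sqrtC (\sum_(i < n) `|x i 0| ^+ 2).

Definition perp n (x y : 'cV[R[i]]_n) : Prop := y^t* *m x = 0.

Definition partial_isometry n (A : 'M[R[i]]_n) : Prop :=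
  forall x : 'cV[R[i]]_n,
    (forall y : 'cV[R[i]]_n, A *m y = 0 -> perp x y) ->
    euclid_norm (A *m x) = euclid_norm x.

(* [eigenspace] is the space of left (row) eigenvectors; its dimension is also
   that of the space of column eigenvectors.  The truncated subtraction is
   harmless: the geometric multiplicity is at most the algebraic one. *)
Definition defect n (A : 'M[R[i]]_n) : nat :=
  (mup 0 (char_poly A) - \rank (eigenspace A 0))%N.

Definition circ_equiv n (A B : 'M[R[i]]_n) : Prop :=
  exists (U : 'M[R[i]]_n) (theta : R),
    U \is unitarymx /\ B = expi theta *: (U *m A *m U^t*).

Definition Re_mx n (X : 'M[R[i]]_n) : 'M[R[i]]_n := 2^-1 *: (X + X^t*).

(* [P_A(lambda, theta)] as a polynomial in [lambda]. *)
Definition kippenhahn_poly n (A : 'M[R[i]]_n) (theta : R) : {poly R[i]} :=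
  \det (map_mx polyC (Re_mx (expi theta *: A)) - 'X%:M).

(* [C(A)] contains the circle of radius [r] centered at the origin. *)
Definition contains_circle0 n (A : 'M[R[i]]_n) (r : R) : Prop :=
  forall theta : R, ('X^2 - (r ^+ 2)%:C%:P) %| kippenhahn_poly A theta.

(* [C(A)] contains the circle of radius [r] centered at [a]. *)
Definition contains_circle n (A : 'M[R[i]]_n) (a : R[i]) (r : R) : Prop :=
  contains_circle0 (A - a%:M) r.

Definition M_rows (b c d e f g h : R) : seq (seq R) :=
  [:: [:: 0; 0; 0; 1; 0; 0];
      [:: 0; 0; 0; 0; b; 0];
      [:: 0; 0; 0; 0; c; e];
      [:: 0; 0; 0; 0; d; f];
      [:: 0; 0; 0; 0; 0; g];
      [:: 0; 0; 0; 0; 0; h]].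

Definition M_mx (b c d e f g h : R) : 'M[R[i]]_6 :=
  \matrix_(i < 6, j < 6) ((nth [::] (M_rows b c d e f g h) i)`_j)%:C.

Definition M_params (b c d e f g h : R) : Prop :=
  [/\ [/\ 0 <= b, 0 <= c, 0 <= d, 0 <= e & 0 <= h],
      (if c * e == 0 then 0 <= f else f <= 0)
    & (e = 0 -> c = 0)].

Definition p_fun (b c e g h rho : R) : R :=
  h * rho ^+ 2 - 2^-1 * h * rho
  + 16^-1 * ((b ^+ 2 + c ^+ 2) * h - c * e * g).

Definition q_fun (b c e h rho : R) : R :=
  rho ^+ 3 - 4^-1 * (3 - h ^+ 2) * rho ^+ 2
  + 16^-1 * (c ^+ 2 + b ^+ 2 + e ^+ 2 + 1 - h ^+ 2) * rho
  - 64^-1 * (b ^+ 2 * e ^+ 2).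

Definition pq_solution (b c e g h rho : R) : Prop :=
  [/\ 0 < rho, rho < 1, p_fun b c e g h rho = 0 & q_fun b c e h rho = 0].

End Kippenhahn.

(* Main.v *)
Require Import Defs.
From HB Require Import structures.
From mathcomp Require Import all_boot all_order all_algebra.
From mathcomp Require Import ring lra.
From mathcomp Require Import complex.
From mathcomp Require Import reals trigo.

Set Implicit Arguments.
Unset Strict Implicit.
Unset Printing Implicit Defensive.

Import Order.TTheory GRing.Theory Num.Theory.
Local Open Scope complex_scope.
Local Open Scope ring_scope.
Local Open Scope sesquilinear_scope.

(** The matrix [A] has rank three, so in an orthonormal basis starting with one
    of its kernel it reads [[0 B]; [0 C]] with 3x3 blocks, and being a partial
    isometry forces [B^* B + C^* C = 1] ([gram_isometry_block]).  The
    hypothesis on the defect says that the characteristic polynomial of [A] is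
    [X^5 (X - h)] ([char_poly_defect]).  Schur triangularization of [C], with
    the eigenvalues in the order 0, 0, h, followed by a lower triangularization
    of [B] and a diagonal unitary change of phases, gives the normal form [M],
    except that the entry [g] may still be non-real when [c <> 0]
    ([canonical_form]).

    The center: writing [z] for [e^{-i theta}], a circle of center [a] and
    radius [r] makes [det (2 r z - (N + z^2 N^* ))], with [N = A - a], vanish on
    the unit circle, hence identically in [z]; the same holds for [- r].  So the
    characteristic polynomial of [N + z^2 N^*] over the polynomials in [z] has
    the roots [2 r z] and [- 2 r z], and [z := 0] shows that [a] is a double
    eigenvalue of [A] ([circle_center]).  As 0 is the only possible multiple
    eigenvalue, [a = 0].

    The radius: eliminating the scalar block [- lambda I] of
    [Re (e^{i theta} A) - lambda], the Kippenhahn polynomial at a nonzero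
    [lambda] becomes, up to sign, a 3x3 determinant
    ([kippenhahn_block]), which evaluates to
    [q(lambda^2) - lambda L(theta)] with
    [L(theta) = cos theta p(lambda^2) + (c e Im g / 16) sin theta], where the
    real part of [g] enters [p] ([kippenhahn_canon_mx_real]).  Divisibility by
    [lambda^2 - r^2] for all [theta] thus amounts to
    [q(r^2) = p(r^2) = c e Im g = 0].  In particular [g] is real as soon as a
    circle is present and [c e <> 0]; and [q(rho) > 0] for [rho >= 1]
    ([q_fun_gt0]), so [r < 1]. *)

(** * Unitary matrices and ordered Schur triangularization *)

Section Unitary.
Variable C : numClosedFieldType.

Lemma adjmx_mul m n p (X : 'M[C]_(m, n)) (Y : 'M[C]_(n, p)) :
  (X *m Y)^t* = Y^t* *m X^t*.
Proof. by rewrite trmx_mul map_mxM. Qed.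

Lemma adjmxD m n (X Y : 'M[C]_(m, n)) : (X + Y)^t* = X^t* + Y^t*.
Proof. by rewrite linearD /= map_mxD. Qed.

Lemma adjmxZ m n (a : C) (X : 'M[C]_(m, n)) : (a *: X)^t* = a^* *: X^t*.
Proof. by rewrite linearZ /= map_mxZ. Qed.

Lemma adj_unitarymx n (U : 'M[C]_n) : U \is unitarymx -> U^t* *m U = 1%:M.
Proof. by move=> /unitarymxP /mulmx1C. Qed.

Lemma unitarymx_col m1 m2 n (X : 'M[C]_(m1, n)) (Y : 'M[C]_(m2, n)) :
  X \is unitarymx -> Y \is unitarymx -> X *m Y^t* = 0 ->
  col_mx X Y \is unitarymx.
Proof.
move=> /unitarymxP hX /unitarymxP hY hXY; apply/unitarymxP.
rewrite tr_col_mx map_row_mx mul_col_row hX hY hXY.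
have -> : Y *m X^t* = 0 by rewrite -[LHS]trmxCK adjmx_mul trmxCK hXY trmx0 map_mx0.
by rewrite -scalar_mx_block.
Qed.

Lemma unitarymx_block_diag m n (U : 'M[C]_m) (V : 'M[C]_n) :
  U \is unitarymx -> V \is unitarymx -> block_mx U 0 0 V \is unitarymx.
Proof.
move=> /unitarymxP hU /unitarymxP hV; apply/unitarymxP.
rewrite tr_block_mx map_block_mx mulmx_block !trmx0 !map_mx0 hU hV.
by rewrite !mul0mx !mulmx0 !addr0 add0r -scalar_mx_block.
Qed.

(** Every row space of dimension [r] has an orthonormal basis of [r] rows. *)
Lemma unitary_row_base m n (V : 'M[C]_(m, n)) r :
  \rank V = r -> exists2 X : 'M[C]_(r, n), X \is unitarymx & (X :=: V)%MS.
Proof.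
move=> <-; exists (schmidt (row_base V)).
  by rewrite schmidt_unitarymx ?rank_leq_col.
apply: eqmx_trans (eq_row_base V).
exact: (eqmx_schmidt_free (row_base_free V)).
Qed.

(** Orthonormal rows extend to an orthonormal basis. *)
Lemma unitary_complete m n (X : 'M[C]_(m, m + n)) : X \is unitarymx ->
  exists Y : 'M[C]_(n, m + n), col_mx X Y \is unitarymx.
Proof.
move=> hX.
have [|Y hY eqY] := @unitary_row_base _ _ (kermx (X^t* )) n.
  by rewrite mxrank_ker mxrank_map mxrank_tr (mxrank_unitary hX) addKn.
exists Y; apply: unitarymx_col => //.
have /sub_kermxP hYX : (Y <= kermx (X^t* ))%MS by rewrite eqY.
by rewrite -[LHS]trmxCK adjmx_mul trmxCK hYX trmx0 map_mx0.
Qed.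

(** A matrix without full row rank is annihilated by a unit row; [unitarymx]
    on a single row means that it has norm 1. *)
Lemma unitary_ker_vector m n (V : 'M[C]_(n, m)) : (\rank V < n)%N ->
  exists2 x : 'rV[C]_n, x \is unitarymx & x *m V = 0.
Proof.
move=> hV; have [X hX eqX] := unitary_row_base (erefl (\rank (kermx V))).
have : (0 < \rank (kermx V))%N by rewrite mxrank_ker subn_gt0.
case: (\rank _) X hX eqX => // r X hX eqX _.
exists (row 0 X).
  apply/row_unitarymxP => i j.
  have /row_unitarymxP/(_ 0 0) := hX; rewrite !ord1 !eqxx => <-.
  by congr (dotmx _ _); apply/rowP => k; rewrite !mxE.
by apply/sub_kermxP; rewrite -eqX row_sub.
Qed.

Lemma char_poly_unitary n (U A : 'M[C]_n) : U \is unitarymx ->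
  char_poly (U *m A *m U^t*) = char_poly A.
Proof.
move=> hU; pose P := @polyC C.
have hP : map_mx P U *m map_mx P (U^t* ) = 1%:M.
  by rewrite -map_mxM (unitarymxP hU) map_mx1.
rewrite /char_poly /char_poly_mx.
have -> : 'X%:M - map_mx P (U *m A *m U^t*) =
    map_mx P U *m ('X%:M - map_mx P A) *m map_mx P (U^t* ).
  rewrite mulmxBr mulmxBl scalar_mxC -[X in _ = X - _]mulmxA hP mulmx1.
  by congr (_ - _); rewrite !map_mxM.
by rewrite !det_mulmx mulrAC -det_mulmx hP det1 mul1r.
Qed.

Lemma char_poly_ublock m n (A : 'M[C]_m) (B : 'M[C]_(m, n)) (D : 'M[C]_n) :
  char_poly (block_mx A B 0 D) = char_poly A * char_poly D.
Proof.
rewrite /char_poly /char_poly_mx map_block_mx scalar_mx_block opp_block_mx.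
by rewrite add_block_mx map_mx0 subr0 det_ublock.
Qed.

(** Schur triangularization in which the order of the eigenvalues on the
    diagonal is prescribed: the head of the list comes first. *)
Lemma schur_upper (s : seq C) (A : 'M[C]_(size s)) :
  char_poly A = \prod_(x <- s) ('X - x%:P) ->
  exists2 U : 'M[C]_(size s), U \is unitarymx &
    forall i j : 'I_(size s), (j <= i)%N ->
      (U *m A *m U^t*) i j = s`_i *+ (i == j).
Proof.
elim: s A => [|a s IHs] /= A hA.
  by exists 1%:M; [apply/unitarymxP; rewrite trmx1 map_mx1 mulmx1 | case].
(* x is the adjoint of a unit right eigenvector for the head eigenvalue. *)
have [|x hx hxA] := @unitary_ker_vector _ _ ((A - a%:M)^t* ).
  rewrite mxrank_map mxrank_tr ltn_neqAle rank_leq_row andbT.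
  have : root (char_poly A) a by rewrite hA big_cons rootM root_XsubC eqxx.
  rewrite -eigenvalue_root_char /eigenvalue /eigenspace.
  by rewrite -mxrank_eq0 mxrank_ker subn_eq0 -ltnNge ltn_neqAle => /andP[].
have [Y hU] := unitary_complete hx.
set U := col_mx x Y in hU.
have hAx : A *m x^t* = a *: x^t*.
  have := congr1 (fun M => M^t*) hxA.
  rewrite /= adjmx_mul trmxCK trmx0 map_mx0 mulmxBl mul_scalar_mx => /eqP.
  by rewrite subr_eq0 => /eqP.
have /unitarymxP := hU; rewrite tr_col_mx map_row_mx mul_col_row.
rewrite [in RHS](scalar_mx_block 1 (size s)) => /eq_block_mx[_ _ hYx _].
have hUA : U *m A *m U^t* =
    block_mx (a%:M : 'M_1) (x *m A *m Y^t*) 0 (Y *m A *m Y^t*).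
  rewrite tr_col_mx map_row_mx mul_col_mx mul_col_row.
  rewrite -!mulmxA hAx -!scalemxAr hYx scaler0 scalemxAr.
  by congr (block_mx _ _ _ _); rewrite -scalemxAr (unitarymxP hx) scale_scalar_mx mulr1.
have hc : char_poly (Y *m A *m Y^t*) = \prod_(y <- s) ('X - y%:P).
  have := char_poly_unitary A hU; rewrite hUA hA.
  rewrite (char_poly_ublock (a%:M : 'M_1)) big_cons.
  rewrite {1}/char_poly det_mx11 !mxE /= !mulr1n.
  by apply: mulfI; rewrite polyXsubC_eq0.
have [V hV hVT] := IHs _ hc.
pose W : 'M[C]_(1 + size s) := block_mx 1%:M 0 0 V.
have hW : W \is unitarymx.
  by apply: unitarymx_block_diag => //; apply/unitarymxP; rewrite trmx1 map_mx1 mulmx1.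
have hT : W *m block_mx (a%:M : 'M_1) (x *m A *m Y^t*) 0 (Y *m A *m Y^t*) *m W^t*
    = block_mx (a%:M : 'M_1) (x *m A *m Y^t* *m V^t*) 0
        (V *m (Y *m A *m Y^t*) *m V^t*).
  rewrite tr_block_mx map_block_mx !trmx0 !map_mx0 trmx1 map_mx1 !mulmx_block.
  by rewrite !(mul0mx, mulmx0, mul1mx, mulmx1, addr0, add0r).
exists (W *m U); first exact: mul_unitarymx.
have -> : W *m U *m A *m (W *m U)^t* = block_mx (a%:M : 'M_1)
    (x *m A *m Y^t* *m V^t*) 0 (V *m (Y *m A *m Y^t*) *m V^t*).
  by rewrite -hT -hUA adjmx_mul !mulmxA.
suff key (i j : 'I_(1 + size s)) : (j <= i)%N ->
    block_mx (a%:M : 'M_1) (x *m A *m Y^t* *m V^t*) 0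
      (V *m (Y *m A *m Y^t*) *m V^t*) i j = (a :: s)`_i *+ (i == j).
  by move=> i j; apply: key.
case: (@split_ordP 1 (size s) i) => i' ->; case: (@split_ordP 1 (size s) j) => j' -> hij.
- by rewrite block_mxEul !ord1 !mxE eqxx.
- by move: hij; rewrite /= ord1.
- rewrite block_mxEdl mxE.
  by rewrite [_ == _](_ : _ = false) //; apply/eqP => /(congr1 val) /=; rewrite ord1.
by rewrite block_mxEdr hVT //= (inj_eq (@rshift_inj 1 _)).
Qed.

End Unitary.

(** * Partial isometries in block form *)

Section PartialIsometry.
Variable C : numClosedFieldType.

(** Preservation of the norm on the orthogonal complement of the kernel, with
    squared norms written as Gram matrices. *)
Definition gram_isometry n (A : 'M[C]_n) : Prop :=
  forall x : 'cV[C]_n, (forall y : 'cV[C]_n, A *m y = 0 -> y^t* *m x = 0) ->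
  (A *m x)^t* *m (A *m x) = x^t* *m x.

(** Over the complex numbers a sesquilinear form is determined by its
    diagonal values (polarization). *)
Lemma sesqui_form_eq0 n (D : 'M[C]_n) :
  (forall x : 'cV[C]_n, x^t* *m D *m x = 0) -> D = 0.
Proof.
move=> hD.
have pol (x y : 'cV[C]_n) (a : C) :
    a^* *: (y^t* *m D *m x) + a *: (x^t* *m D *m y) = 0.
  have := hD (x + a *: y); rewrite adjmxD adjmxZ.
  rewrite !(mulmxDl, mulmxDr) -!scalemxAl -!scalemxAr !hD.
  by rewrite !scaler0 add0r addr0 addrC.
apply/matrixP => i j.
have E : (delta_mx i 0 : 'cV[C]_n)^t* *m D *m delta_mx j 0 = (D i j)%:M.
  rewrite trmx_delta map_delta_mx -rowE -colE; apply/matrixP => k l.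
  by rewrite !ord1 !mxE mulr1n.
have h1 := pol (delta_mx i 0) (delta_mx j 0) 1.
have h2 := pol (delta_mx i 0) (delta_mx j 0) 'i.
move: h1 h2; rewrite conjC1 !scale1r => /eqP; rewrite addr_eq0 => /eqP ->.
rewrite conjCi scaleNr scalerN opprK -mulr2n -scaler_nat => /eqP.
rewrite scaler_eq0 pnatr_eq0 /= scaler_eq0 (negPf (neq0Ci _)) /= E.
by move=> /eqP/matrixP/(_ 0 0); rewrite !mxE mulr1n.
Qed.

(** If a unitary similarity and a rotation annihilate all columns but as many
    as the rank, then the remaining columns are orthonormal. *)
Lemma gram_isometry_block m k (A U : 'M[C]_(m + k)) X Y (w : C) :
  gram_isometry A -> \rank A = k -> U \is unitarymx -> w * w^* = 1 ->
  w *: (U *m A *m U^t*) = block_mx 0 X 0 Y ->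
  X^t* *m X + Y^t* *m Y = 1%:M.
Proof.
move=> hA rA hU hw hT; apply/eqP; rewrite -subr_eq0; apply/eqP.
have hU' := adj_unitarymx hU.
have w0 : w != 0.
  by apply: contra_eq_neq hw => ->; rewrite mul0r eq_sym oner_eq0.
pose Z : 'M[C]_(m + k, k) := col_mx X Y.
have hZ : w *: (U *m A *m U^t*) = row_mx 0 Z.
  by rewrite hT /Z block_mxEh col_mx0.
(* Z has full column rank, so its columns correspond to the orthogonal
   complement of the kernel. *)
have fZ : row_full Z.
  rewrite -col_leq_rank -{1}rA.
  have -> : A = (w^-1 *: U^t*) *m (Z *m row_mx 0 1%:M) *m U.
    rewrite mul_mx_row mulmx0 mulmx1 -hZ -scalemxAr -!scalemxAl.
    rewrite scalerA mulfV // scale1r !mulmxA hU' mul1mx.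
    by rewrite -mulmxA hU' mulmx1.
  apply: leq_trans (mxrankM_maxl _ _) _; apply: leq_trans (mxrankM_maxr _ _) _.
  exact: mxrankM_maxl.
apply: sesqui_form_eq0 => v.
pose x := U^t* *m col_mx 0 v.
have hUx : U *m x = col_mx 0 v by rewrite mulmxA (unitarymxP hU) mul1mx.
have hZv : w *: (U *m (A *m x)) = Z *m v.
  rewrite /x !mulmxA scalemxAl hZ mul_row_col mul0mx add0r //.
have := hA x.
have -> : (A *m x)^t* *m (A *m x) = (Z *m v)^t* *m (Z *m v).
  rewrite -hZv adjmxZ -scalemxAl -scalemxAr scalerA mulrC hw scale1r.
  by rewrite [(U *m _)^t*]adjmx_mul -!mulmxA [U^t* *m _]mulmxA hU' mul1mx.
have -> : x^t* *m x = v^t* *m v.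
  rewrite -[X in _^t* *m X = _]mul1mx -hU' -mulmxA mulmxA -adjmx_mul hUx.
  by rewrite tr_col_mx map_row_mx mul_row_col mulmx0 add0r.
rewrite adjmx_mul -!mulmxA [Z^t* *m _]mulmxA => h.
have {}h : v^t* *m (Z^t* *m Z *m v) = v^t* *m v.
  apply: h => y hy.
  have hZy : Z *m dsubmx (U *m y) = 0.
    have : row_mx 0 Z *m (U *m y) = 0.
      by rewrite -hZ -scalemxAl -!mulmxA [U^t* *m _]mulmxA hU' mul1mx hy mulmx0 scaler0.
    by rewrite -{1}[U *m y]vsubmxK mul_row_col mul0mx add0r.
  have {}hZy : dsubmx (U *m y) = 0 by apply: (row_full_inj fZ); rewrite mulmx0.
  rewrite /x mulmxA -adjmx_mul -[U *m y]vsubmxK hZy.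
  by rewrite tr_col_mx map_row_mx mul_row_col mulmx0 trmx0 map_mx0 mul0mx addr0.
move: h; rewrite {1 2}/Z tr_col_mx map_row_mx mul_row_col => h.
by rewrite mulmxBl mul1mx mulmxBr h subrr.
Qed.

End PartialIsometry.

(** * Reduction to the canonical form *)

Section Reduction.
Variable C : numClosedFieldType.

(** In an orthonormal basis that starts with one of the kernel, the first
    columns vanish. *)
Lemma kernel_block m k (A : 'M[C]_(m + k)) : \rank A = k ->
  exists2 U : 'M[C]_(m + k), U \is unitarymx &
    exists X Y, U *m A *m U^t* = block_mx 0 X 0 Y.
Proof.
move=> rA; have [|X hX eqX] := @unitary_row_base _ _ _ (kermx (A^t* )) m.
  by rewrite mxrank_ker mxrank_map mxrank_tr rA addnK.
have [Y hU] := unitary_complete hX; exists (col_mx X Y) => //.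
have hAX : A *m X^t* = 0.
  have /sub_kermxP h : (X <= kermx (A^t* ))%MS by rewrite eqX.
  by rewrite -[LHS]trmxCK adjmx_mul trmxCK h trmx0 map_mx0.
exists (X *m A *m Y^t*), (Y *m A *m Y^t*).
rewrite tr_col_mx map_row_mx mul_col_mx mul_col_row.
by rewrite -!(mulmxA _ A (X^t* )) hAX !mulmx0.
Qed.

(** Upper right block of the canonical form. *)
Definition canonB (b c e : C) : 'M[C]_3 :=
  \matrix_(i < 3, j < 3)
    (nth [::] [:: [:: 1; 0; 0]; [:: 0; b; 0]; [:: 0; c; e]] i)`_j.

(** Lower right block of the canonical form. *)
Definition canonC (d f g h : C) : 'M[C]_3 :=
  \matrix_(i < 3, j < 3)
    (nth [::] [:: [:: 0; d; f]; [:: 0; 0; g]; [:: 0; 0; h]] i)`_j.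

Lemma ord3P (i : 'I_3) : [\/ i = 0, i = inord 1 | i = inord 2].
Proof.
case: i => [[|[|[|//]]]] hi; [apply: Or31 | apply: Or32 | apply: Or33];
by apply: val_inj; rewrite /= ?inordK.
Qed.

(** A 3x3 matrix whose first column is a unit vector orthogonal to the others
    is brought to the shape [canonB] by a unitary factor on the left.  The last
    clause [e = 0 -> c = 0] is the normalization of the degenerate case. *)
Lemma col_lower_triangular (X : 'M[C]_3) :
  (forall j, (X^t* *m X) 0 j = (0 == j)%:R) ->
  exists2 V : 'M[C]_3, V \is unitarymx &
    exists b c e, V *m X = canonB b c e /\ (e = 0 -> c = 0).
Proof.
move=> hX.
have dot (x : 'rV[C]_3) j : x *m col j X = 0 -> (x *m X) 0 j = 0.
  move=> h; have <- : (x *m col j X) 0 0 = 0 by rewrite h mxE.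
  by rewrite [LHS]mxE [RHS]mxE; apply: eq_bigr => k _; rewrite [in RHS]mxE.
pose x1 := (col 0 X)^t*.
have x1X : x1 *m X = row 0 (X^t* *m X).
  by apply/rowP => j; rewrite !mxE; apply: eq_bigr => k _; rewrite !mxE.
have hx1 : x1 \is unitarymx.
  apply/unitarymxP; rewrite trmxCK; apply/matrixP => i j; rewrite !ord1.
  have := hX 0; rewrite !mxE => <-.
  by apply: eq_bigr => k _; rewrite !mxE.
have sub0 p (x : 'rV[C]_3) (v w : 'M[C]_(3, p)) : x *m row_mx v w = 0 ->
    x *m v = 0 /\ x *m w = 0.
  by rewrite mul_mx_row => /eqP; rewrite row_mx_eq0 => /andP[/eqP-> /eqP->].
have conj0 (x y : 'rV[C]_3) : x *m y^t* = 0 -> y *m x^t* = 0.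
  by move=> h; rewrite -[LHS]trmxCK adjmx_mul trmxCK h trmx0 map_mx0.
have x1_col j : x1 *m col j X = 0 \/ j = 0.
  have [->|j0] := eqVneq j 0; [by right | left].
  apply/matrixP => k l; rewrite !ord1 [RHS]mxE.
  transitivity ((x1 *m X) 0 j); last by rewrite x1X mxE hX eq_sym (negPf j0).
  by rewrite [LHS]mxE [RHS]mxE; apply: eq_bigr => i _; rewrite !mxE.
have mkV (x2 x3 : 'rV[C]_3) : x2 \is unitarymx -> x3 \is unitarymx ->
    x2 *m col 0 X = 0 -> x3 *m col 0 X = 0 -> x3 *m x2^t* = 0 ->
    (col_mx x1 (col_mx x2 x3) : 'M_(1 + (1 + 1), 3)) \is unitarymx.
  move=> hx2 hx3 h21 h31 h32; apply: unitarymx_col => //.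
    by apply: unitarymx_col => //; apply: conj0.
  rewrite tr_col_mx map_row_mx mul_mx_row -!adjmx_mul h21 h31.
  by rewrite trmx0 map_mx0 row_mx0.
(* x2 must kill columns 0 and 2.  If column 2 vanishes there is freedom left,
   which is used to make x3 kill column 1, so that c = 0. *)
have [x2 [x3 [[hx2 hx3] [h21 h31] [h23 h22 h32]]]] :
    exists x2 x3 : 'rV[C]_3, [/\ x2 \is unitarymx /\ x3 \is unitarymx,
      x2 *m col 0 X = 0 /\ x3 *m col 0 X = 0 &
      [/\ x3 *m x2^t* = 0, x2 *m col (inord 2) X = 0 &
        x3 *m col (inord 2) X = 0 -> x3 *m col (inord 1) X = 0]].
  have ker2 (u v : 'cV[C]_3) :
      exists2 x : 'rV[C]_3, x \is unitarymx & x *m u = 0 /\ x *m v = 0.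
    have [|x hx /sub0 h] := @unitary_ker_vector _ _ _ (row_mx u v).
      by rewrite ltnS rank_leq_col.
    by exists x.
  have [h0|h0] := eqVneq (col (inord 2) X) 0.
    have [x3 hx3 [h31 h33]] := ker2 (col 0 X) (col (inord 1) X).
    have [x2 hx2 [h21 h23]] := ker2 (col 0 X) (x3^t* ).
    exists x2, x3; split=> //; split=> //; first exact: conj0.
    by rewrite h0 mulmx0.
  have [x2 hx2 [h21 h22]] := ker2 (col 0 X) (col (inord 2) X).
  have [x3 hx3 [h31 h32]] := ker2 (col 0 X) (x2^t* ).
  exists x2, x3; split=> //; split=> // h.
  (* The nonzero column 2 would be orthogonal to an orthonormal basis. *)
  case/eqP: h0; have hV := mkV _ _ hx2 hx3 h21 h31 h32.
  have [h12|/(congr1 val)] := x1_col (inord 2); last by rewrite /= inordK.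
  have /(congr1 (mulmx ((col_mx x1 (col_mx x2 x3))^t* ))) :
      col_mx x1 (col_mx x2 x3) *m col (inord 2) X = 0.
    by rewrite !mul_col_mx h12 h22 h !col_mx0.
  by rewrite mulmxA adj_unitarymx // mul1mx mulmx0.
have hV := mkV _ _ hx2 hx3 h21 h31 h23.
exists (col_mx x1 (col_mx x2 x3) : 'M_(1 + (1 + 1), 3)) => //.
exists ((x2 *m X) 0 (inord 1)), ((x3 *m X) 0 (inord 1)), ((x3 *m X) 0 (inord 2)).
split; last first.
  have e (x : 'rV[C]_3) j : (x *m X) 0 j = (x *m col j X) 0 0.
    by rewrite [LHS]mxE [RHS]mxE; apply: eq_bigr => k _; rewrite [in RHS]mxE.
  rewrite !e => h; rewrite h32 ?mxE //.
  by apply/matrixP => k l; rewrite !ord1 h mxE.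
transitivity (col_mx (x1 *m X) (col_mx (x2 *m X) (x3 *m X))).
  by rewrite -!mul_col_mx.
rewrite x1X; apply/matrixP => i j.
case: (@split_ordP 1 2 i) => i1 ->; last case: (@split_ordP 1 1 i1) => i2 ->.
- rewrite (@col_mxEu _ 1 2) ord1 [LHS]mxE hX [RHS]mxE.
  by case: (ord3P j) => ->; rewrite -?val_eqE /= ?inordK.
- rewrite (@col_mxEd _ 1 2) (@col_mxEu _ 1 1) ord1 [RHS]mxE /=.
  by case: (ord3P j) => ->; rewrite /= ?inordK // dot.
rewrite (@col_mxEd _ 1 2) (@col_mxEd _ 1 1) ord1 [RHS]mxE /=.
by case: (ord3P j) => ->; rewrite /= ?inordK // dot.
Qed.

Lemma conj_block_diag m k (A U : 'M[C]_(m + k)) X Y V W :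
  U *m A *m U^t* = block_mx 0 X 0 Y ->
  let D : 'M[C]_(m + k) := block_mx V 0 0 W in
  (D *m U) *m A *m (D *m U)^t* = block_mx 0 (V *m X *m W^t*) 0 (W *m Y *m W^t*).
Proof.
move=> hU D; rewrite adjmx_mul !mulmxA -(mulmxA D U) -(mulmxA D (U *m A)) hU.
rewrite tr_block_mx map_block_mx !mulmx_block !trmx0 !map_mx0.
by rewrite !(mul0mx, mulmx0, addr0, add0r).
Qed.

(** The geometric multiplicity of 0 is 3, so its algebraic one is at least 5. *)
Lemma char_poly_defect (A : 'M[C]_6) :
  \rank A = 3 -> (2 <= mup 0 (char_poly A) - \rank (eigenspace A 0))%N ->
  exists h, char_poly A = ('X^5 * ('X - h%:P)).
Proof.
move=> rA; rewrite /eigenspace mxrank_ker raddf0 subr0 rA => hd.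
have hm : (5 <= mup 0 (char_poly A))%N by move: hd; case: mup => [|[|[|[|[|]]]]].
have mA := char_poly_monic A.
move: hm; rewrite mup_geq ?monic_neq0 // subr0 => /dvdpP [q hq].
have mq : q \is monic by move: mA; rewrite hq monicMr // monicXn.
have sq : size q = 2.
  have := size_char_poly A; rewrite hq size_Mmonic ?monicXn ?monic_neq0 //.
  by rewrite size_polyXn addnS /= -[7%N]/(2 + 5)%N => /addIn.
exists (- q`_0); rewrite hq mulrC; congr (_ * _).
apply/polyP => k; rewrite coefB coefX coefC.
case: k => [|[|k]] /=; rewrite ?sub0r ?opprK ?subr0 //.
  by move/monicP: mq; rewrite lead_coefE sq.
by rewrite nth_default ?sq ?oppr0.
Qed.

(** The matrix [M] of the canonical form, with complex parameters. *)
Definition canon_mx (b c d e f g h : C) : 'M[C]_6 :=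
  block_mx 0 (canonB b c e) 0 (canonC d f g h) : 'M[C]_(3 + 3).

(** Canonical form up to unitary similarity, before the choice of phases. *)
Lemma complex_canonical_form (A : 'M[C]_6) :
  gram_isometry A -> \rank A = 3%N ->
  (2 <= mup 0 (char_poly A) - \rank (eigenspace A 0))%N ->
  exists2 U : 'M[C]_6, U \is unitarymx &
  exists b c d e f g h : C,
    U *m A *m U^t* = canon_mx b c d e f g h /\ (e = 0 -> c = 0).
Proof.
move=> hA rA hd; have [h hc] := char_poly_defect rA hd.
have [U hU [X [Y hUA]]] := @kernel_block 3 3 A rA.
have hY : char_poly Y = \prod_(x <- [:: 0; 0; h]) ('X - x%:P).
  have := char_poly_unitary A hU; rewrite hUA hc (@char_poly_ublock _ 3 3).
  have -> : char_poly (0 : 'M[C]_3) = 'X^3.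
    by rewrite /char_poly /char_poly_mx map_mx0 subr0 det_scalar.
  rewrite -[5%N]/(3 + 2)%N exprD -mulrA => /mulfI ->; last first.
    by rewrite expf_neq0 ?polyX_eq0.
  by rewrite !big_cons big_nil !subr0 mulr1 mulrA expr2.
have [W hW hWY] := @schur_upper _ [:: 0; 0; h] Y hY.
have hWC : exists d f g, W *m Y *m W^t* = canonC d f g h.
  pose T := W *m Y *m W^t*.
  exists (T 0 (inord 1)), (T 0 (inord 2)), (T (inord 1) (inord 2)).
  apply/matrixP => i j; rewrite [RHS]mxE.
  case: (ord3P i) => ->; case: (ord3P j) => ->; rewrite ?inordK //= hWY;
    by rewrite -?val_eqE /= ?(@inordK 2) ?mul0rn.
have [d [f [g {}hWC]]] := hWC.
have [|V hV [b [c [e [hVX hec]]]]] := @col_lower_triangular (X *m W^t* ).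
  have h1 : (1%:M : 'M[C]_3) \is unitarymx.
    by apply/unitarymxP; rewrite trmx1 map_mx1 mulmx1.
  have := @gram_isometry_block _ 3 3 A
    (block_mx 1%:M 0 0 W *m U) (X *m W^t* ) (W *m Y *m W^t*) 1 hA rA.
  rewrite mul_unitarymx ?unitarymx_block_diag // => /(_ isT).
  rewrite conjC1 mulr1 scale1r (conj_block_diag _ _ hUA) mul1mx.
  move=> /(_ erefl erefl) /matrixP hG j.
  have := hG 0 j; rewrite hWC mxE [X in _ + X]mxE big1 => [|k _].
    by rewrite addr0 => ->; rewrite mxE.
  by rewrite !mxE; case: (ord3P k) => ->; rewrite /= ?inordK //= conjC0 mul0r.
exists (block_mx V 0 0 W *m U : 'M_(3 + 3)).
  by apply: mul_unitarymx => //; apply: (@unitarymx_block_diag _ 3 3).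
exists b, c, d, e, f, g, h; split=> //.
by rewrite (conj_block_diag _ _ hUA) -mulmxA hVX hWC.
Qed.

End Reduction.

(** * Normalization of the phases *)

Section Phases.
Variable R : realType.
Local Notation C := R[i].

Lemma euclid_norm_sqr n (x : 'cV[C]_n) : x^t* *m x = (euclid_norm x ^+ 2)%:M.
Proof.
apply/matrixP => i j; rewrite !ord1 /euclid_norm sqrtCK !mxE mulr1n.
by apply: eq_bigr => k _; rewrite !mxE mulrC -normCK.
Qed.

Lemma partial_isometry_gram n (A : 'M[C]_n) :
  partial_isometry A -> gram_isometry A.
Proof. by move=> hA x hx; rewrite !euclid_norm_sqr hA. Qed.

Lemma conjC_real (r : R) : (r%:C : C)^* = r%:C.
Proof. exact: conjc_real. Qed.

Lemma expi_conj (t : R) : (expi t)^* = (cos t -i* sin t) :> C.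
Proof. by []. Qed.

Lemma expi_unit (t : R) : expi t * (expi t)^* = 1.
Proof.
rewrite expi_conj /expi; apply/eqP; rewrite eq_complex /= mulrN opprK -!expr2.
by rewrite cos2Dsin2 eqxx /= mulrN mulrC addNr.
Qed.

Lemma expi_surj (u : C) : u * u^* = 1 -> exists t : R, expi t = u.
Proof.
case: u => x y /eqP; rewrite eq_complex /= mulrN opprK -!expr2 => /andP[/eqP hxy _].
have hx : -1 <= x <= 1 by apply/andP; nra.
have [y0|y0] := leP 0 y.
  exists (acos x); rewrite /expi acosK // sin_acos // -hxy addrAC subrr add0r.
  by rewrite sqrtr_sqr ger0_norm.
exists (- acos x); rewrite /expi cosN sinN acosK // sin_acos // -hxy addrAC subrr add0r.
by rewrite sqrtr_sqr ltr0_norm // opprK.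
Qed.

(** Every complex number becomes a nonnegative real after multiplication by
    some number of modulus 1. *)
Lemma phaseP (x : C) :
  exists2 u : C, u * u^* = 1 & exists2 r : R, 0 <= r & u * x = r%:C.
Proof.
have [->|x0] := eqVneq x 0.
  by exists 1; rewrite ?conjC1 ?mulr1 //; exists 0; rewrite ?mul1r.
have hn : `|x| != 0 by rewrite normr_eq0.
exists (x^* / `|x|).
  rewrite rmorphM /= conjCK fmorphV /= (CrealP (normr_real x)).
  by rewrite mulrACA [x^* * x]mulrC -normCK -invfM expr2 mulfV // mulf_neq0.
exists (complex.Re `|x|); first by have := normr_ge0 x; rewrite lecE => /andP[].
rewrite RRe_real ?normr_real // mulrAC [x^* * x]mulrC -normCK expr2 -mulrA mulfV //.
by rewrite mulr1.
Qed.

(** Effect on the parameters of a rotation by [w] and of a conjugation by the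
    diagonal unitary matrix with entries [p1, p2, p3, q1, q2, q3]; the first
    hypothesis keeps the entry 1 of the canonical form. *)
Lemma canon_mx_phase (b c d e f g h w p1 p2 p3 q1 q2 q3 : C) :
  w * p1 * q1^* = 1 ->
  p1 * p1^* = 1 -> p2 * p2^* = 1 -> p3 * p3^* = 1 ->
  q1 * q1^* = 1 -> q2 * q2^* = 1 -> q3 * q3^* = 1 ->
  exists2 D : 'M[C]_6, D \is unitarymx &
  w *: (D *m canon_mx b c d e f g h *m D^t*) =
  canon_mx (w * p2 * q2^* * b) (w * p3 * q2^* * c) (w * q1 * q2^* * d)
       (w * p3 * q3^* * e) (w * q1 * q3^* * f) (w * q2 * q3^* * g) (w * h).
Proof.
move=> hw h1 h2 h3 h4 h5 h6.
pose dg (x y z : C) : 'M[C]_3 := diag_mx (\row_i [:: x; y; z]`_i).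
have dgE x y z : x * x^* = 1 -> y * y^* = 1 -> z * z^* = 1 -> dg x y z \is unitarymx.
  move=> hx hy hz; apply/unitarymxP; rewrite tr_diag_mx map_diag_mx mulmx_diag.
  apply/matrixP => i j; rewrite !mxE.
  by case: (ord3P i) => ->; rewrite /= ?inordK // ?hx ?hy ?hz.
exists (block_mx (dg p1 p2 p3) 0 0 (dg q1 q2 q3) : 'M_(3 + 3)).
  by apply: (@unitarymx_block_diag _ 3 3); apply: dgE.
have -> : (w *: (block_mx (dg p1 p2 p3) 0 0 (dg q1 q2 q3) *m canon_mx b c d e f g h
      *m (block_mx (dg p1 p2 p3) 0 0 (dg q1 q2 q3))^t*) : 'M_(3 + 3)) =
    block_mx 0 (w *: (dg p1 p2 p3 *m canonB b c e *m (dg q1 q2 q3)^t*))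
             0 (w *: (dg q1 q2 q3 *m canonC d f g h *m (dg q1 q2 q3)^t*)).
  have hD := @conj_block_diag _ 3 3 (canon_mx b c d e f g h) 1%:M (canonB b c e)
     (canonC d f g h) (dg p1 p2 p3) (dg q1 q2 q3).
  rewrite -[in RHS](scaler0 _ w) -scale_block_mx -hD.
    by rewrite mulmx1.
  by rewrite mul1mx trmx1 map_mx1 mulmx1.
have -> : w *: (dg p1 p2 p3 *m canonB b c e *m (dg q1 q2 q3)^t*) =
    canonB (w * p2 * q2^* * b) (w * p3 * q2^* * c) (w * p3 * q3^* * e).
  apply/matrixP => i j.
  rewrite tr_diag_mx map_diag_mx mul_mx_diag mul_diag_mx !mxE.
  case: (ord3P i) => ->; case: (ord3P j) => ->; rewrite /= ?inordK //=;
    try by ring.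
  by rewrite mulr1 mulrA hw.
suff -> : w *: (dg q1 q2 q3 *m canonC d f g h *m (dg q1 q2 q3)^t*) =
    canonC (w * q1 * q2^* * d) (w * q1 * q3^* * f) (w * q2 * q3^* * g) (w * h) by [].
apply/matrixP => i j.
rewrite tr_diag_mx map_diag_mx mul_mx_diag mul_diag_mx !mxE.
case: (ord3P i) => ->; case: (ord3P j) => ->; rewrite /= ?inordK //=;
  try by ring.
by rewrite [q3 * h]mulrC -mulrA h6 mulr1.
Qed.

(** Orthonormality of the last two columns of the canonical form; they are
    orthogonal to the fourth column, which is a unit vector, whatever the
    parameters. *)
Definition gram_eqs (b c d e f g h : C) : Prop :=
  [/\ b^* * b + c^* * c + d^* * d = 1,
      e^* * e + f^* * f + g^* * g + h^* * h = 1 &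
      c^* * e + d^* * f = 0].

Lemma canon_mx_gram (b c d e f g h : C) :
  (canonB b c e)^t* *m canonB b c e + (canonC d f g h)^t* *m canonC d f g h = 1%:M ->
  gram_eqs b c d e f g h.
Proof.
move=> /matrixP hG.
split.
- have := hG (inord 1) (inord 1).
  rewrite !mxE !big_ord_recl !big_ord0 !mxE /= !inordK //= eqxx mulr1n => <-.
  by rewrite conjC0; ring.
- have := hG (inord 2) (inord 2).
  rewrite !mxE !big_ord_recl !big_ord0 !mxE /= !inordK //= eqxx mulr1n => <-.
  by rewrite conjC0; ring.
have := hG (inord 1) (inord 2).
rewrite !mxE !big_ord_recl !big_ord0 !mxE /= !inordK //= -val_eqE /= !inordK //=.
rewrite mulr0n => <-.
by rewrite conjC0; ring.
Qed.

Lemma circ_equiv_gram (A U : 'M[C]_6) (theta : R) (b c d e f g h : C) :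
  partial_isometry A -> \rank A = 3%N -> U \is unitarymx ->
  expi theta *: (U *m A *m U^t*) = canon_mx b c d e f g h ->
  (canonB b c e)^t* *m canonB b c e + (canonC d f g h)^t* *m canonC d f g h = 1%:M.
Proof.
move=> hA rA hU hT; apply: (@gram_isometry_block _ 3 3) rA hU _ hT.
  exact: partial_isometry_gram.
exact: expi_unit.
Qed.

(** Canonical form up to circular equivalence.  Only [g] may fail to be real:
    its phase can be adjusted only if [c = 0].  The predicate [M_params] does
    not constrain [g], whence the dummy argument [g']. *)
Lemma canonical_form (A : 'M[C]_6) :
  partial_isometry A -> \rank A = 3%N -> (2 <= defect A)%N ->
  exists (b c d e f h : R) (g : C),
  [/\ forall g' : R, M_params b c d e f g' h,
      circ_equiv A (canon_mx b%:C c%:C d%:C e%:C f%:C g h%:C) &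
      c = 0 -> exists g' : R, g = g'%:C].
Proof.
move=> hA rA hd.
have [U hU [b [c [d [e [f [g [h [hT hec]]]]]]]]] :=
  complex_canonical_form (partial_isometry_gram hA) rA hd.
have [w hw [rh rh0 hh]] := phaseP h.
(* The phase of the last basis vector is 1; p3 then makes e real, q2 makes c or
   else g real, p2 makes b real, and q1 makes d or else f real. *)
have [p3 hp3 [re re0 he]] := phaseP (w * e).
have [q2 hq2 hcg] : exists2 q2 : C, q2 * q2^* = 1 &
    if c == 0 then exists r : R, w * q2 * g = r%:C
    else exists2 r : R, 0 <= r & w * p3 * q2^* * c = r%:C.
  have [c0|c0] := eqVneq c 0.
    have [u hu [r r0 hr]] := phaseP (w * g).
    by exists u => //; exists r; rewrite -hr; ring.
  have [u hu [r r0 hr]] := phaseP (w * p3 * c).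
  by exists u^*; [rewrite conjCK mulrC | exists r; rewrite // conjCK -hr; ring].
have [p2 hp2 [rb rb0 hb]] := phaseP (w * q2^* * b).
have [q1 hq1 hdf] : exists2 q1 : C, q1 * q1^* = 1 &
    if d == 0 then exists2 r : R, 0 <= r & w * q1 * f = r%:C
    else exists2 r : R, 0 <= r & w * q1 * q2^* * d = r%:C.
  have [d0|d0] := eqVneq d 0.
    have [u hu [r r0 hr]] := phaseP (w * f).
    by exists u => //; exists r; rewrite // -hr; ring.
  have [u hu [r r0 hr]] := phaseP (w * q2^* * d).
  by exists u => //; exists r; rewrite // -hr; ring.
(* p1 := w^* q1 preserves the entry 1. *)
have hp1 : w * (w^* * q1) * q1^* = 1 by rewrite mulrA hw mul1r.
have hp1' : w^* * q1 * (w^* * q1)^* = 1.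
  by rewrite rmorphM /= conjCK mulrACA hq1 mulr1 mulrC.
have hq3 : (1 : C) * 1^* = 1 by rewrite conjC1 mulr1.
have [D hD] := canon_mx_phase b c d e f g h hp1 hp1' hp2 hp3 hq1 hq2 hq3.
have [theta htheta] := expi_surj hw.
have hDU : D *m (U *m A *m U^t*) *m D^t* = (D *m U) *m A *m (D *m U)^t*.
  by rewrite adjmx_mul !mulmxA.
rewrite -hT -htheta hDU htheta conjC1 !mulr1 => hN.
have /canon_mx_gram[_ _ hg] : _ := circ_equiv_gram (theta := theta) hA rA
  (mul_unitarymx hD hU) (etrans (congr1 (fun x => x *: _) htheta) hN).
have unit0 (u : C) : u * u^* = 1 -> u != 0.
  by move=> hu; apply: contra_eq_neq hu => ->; rewrite mul0r eq_sym oner_eq0.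
have hb1 : w * p2 * q2^* * b = rb%:C by rewrite -hb; ring.
have he1 : w * p3 * e = re%:C by rewrite -he; ring.
rewrite hb1 he1 hh in hN; rewrite he1 in hg.
have hre : re = 0 -> c = 0.
  move=> re0'; apply/hec/eqP; move/eqP: he1.
  by rewrite re0' !mulf_eq0 (negPf (unit0 _ hw)) (negPf (unit0 _ hp3)).
have [rc [rc0 hc1 hrc hg1]] : exists rc : R, [/\ 0 <= rc,
    w * p3 * q2^* * c = rc%:C, c = 0 -> rc = 0 &
    rc = 0 -> exists g' : R, w * q2 * g = g'%:C].
  move: hcg; have [->|c0] := eqVneq c 0 => [h1|[r r0 hr]].
    by exists 0; split; rewrite ?mulr0.
  exists r; split=> // [/eqP|r0']; first by rewrite (negPf c0).
  move/eqP: hr; rewrite r0' !mulf_eq0 conjC_eq0 (negPf c0).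
  by rewrite (negPf (unit0 _ hw)) (negPf (unit0 _ hp3)) (negPf (unit0 _ hq2)).
rewrite hc1 conjC_real -rmorphM /= in hg; rewrite hc1 in hN.
(* Orthogonality of the last two columns gives rc re + d f = 0, which makes f
   real when d <> 0 and determines its sign. *)
have [rd [rf [rd0 hd1 hf1 hrf]]] : exists rd rf : R, [/\ 0 <= rd,
    w * q1 * q2^* * d = rd%:C, w * q1 * f = rf%:C &
    if rc * re == 0 then 0 <= rf else rf <= 0].
  move: hdf hg; have [->|d0] := eqVneq d 0 => [[r r0 hr]|[r r0 hr]].
    rewrite mulr0 conjC0 mul0r addr0 => /complexI ->.
    by exists 0, r; rewrite eqxx.
  rewrite hr conjC_real => hcd.
  have r0' : r != 0.
    move/eqP: hr; apply: contraTneq => ->; rewrite !mulf_eq0 conjC_eq0 (negPf d0).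
    by rewrite (negPf (unit0 _ hw)) (negPf (unit0 _ hq1)) (negPf (unit0 _ hq2)).
  exists r, (- (rc * re) / r); split=> //; last first.
    have [->|_] := eqVneq (rc * re) 0; first by rewrite oppr0 mul0r.
    by rewrite mulNr oppr_le0 divr_ge0 // mulr_ge0.
  apply: (@mulfI _ r%:C); first by rewrite fmorph_eq0.
  rewrite -[RHS]rmorphM /= [r * _]mulrCA mulfV // mulr1 rmorphN.
  by move/eqP: hcd; rewrite addrC addr_eq0 => /eqP.
rewrite hd1 hf1 in hN.
exists rb, rc, rd, re, rf, rh, (w * q2 * g); split=> //.
  by move=> g'; split=> // /hre.
by exists (D *m U), theta; rewrite htheta hN mul_unitarymx.
Qed.

End Phases.

(** * The Kippenhahn polynomial of the canonical form *)

Lemma det_mx33 (F : comRingType) (A : 'M[F]_3) :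
  \det A =
    A 0 0 * (A (inord 1) (inord 1) * A (inord 2) (inord 2)
             - A (inord 1) (inord 2) * A (inord 2) (inord 1))
  - A 0 (inord 1) * (A (inord 1) 0 * A (inord 2) (inord 2)
             - A (inord 1) (inord 2) * A (inord 2) 0)
  + A 0 (inord 2) * (A (inord 1) 0 * A (inord 2) (inord 1)
             - A (inord 1) (inord 1) * A (inord 2) 0).
Proof.
rewrite (expand_det_row _ 0) !big_ord_recl big_ord0 /cofactor.
rewrite !(expand_det_row _ 0) !big_ord_recl !big_ord0 /cofactor !det_mx11 !mxE.
have E1 : inord 1 = lift ord0 ord0 :> 'I_3 by apply: val_inj; rewrite /= inordK.
have E2 : inord 2 = lift ord0 (lift ord0 ord0) :> 'I_3.
  by apply: val_inj; rewrite /= inordK.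
have E (i : 'I_3) j : (i : nat) = j -> i = inord j :> 'I_3.
  by move=> <-; rewrite inord_val.
rewrite -?E1 -?E2.
do 10? [match goal with |- context [lift ?x ?y] => rewrite (E (lift x y) _ erefl) /= end].
have E0 : inord 0 = 0 :> 'I_3 by apply: val_inj; rewrite /= inordK.
rewrite !inordK // /bump /= ?E0.
ring.
Qed.

Section Kippenhahn.
Variable R : realType.
Local Notation C := R[i].

Lemma kippenhahn_horner n (A : 'M[C]_n) theta l :
  (kippenhahn_poly A theta).[l] = \det (Re_mx (expi theta *: A) - l%:M).
Proof.
rewrite /kippenhahn_poly -horner_evalE -det_map_mx; congr (\det _).
apply/matrixP => i j; rewrite !mxE rmorphB rmorphMn /= /horner_eval hornerC.
by rewrite hornerX.
Qed.

(** As [r <> 0], divisibility by [X^2 - r^2] amounts to the roots [r] and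
    [- r]. *)
Lemma contains_circle0P n (A : 'M[C]_n) (r : R) : 0 < r ->
  contains_circle0 A r <->
  forall theta, (kippenhahn_poly A theta).[r%:C] = 0 /\
                (kippenhahn_poly A theta).[- r%:C] = 0.
Proof.
move=> r0.
have E : 'X^2 - (r ^+ 2)%:C%:P = ('X - r%:C%:P) * ('X - (- r%:C)%:P) :> {poly C}.
  by rewrite !rmorphXn rmorphN; ring.
have rr : r%:C != - r%:C.
  by rewrite -rmorphN (inj_eq (@complexI _)) -addr_eq0 -mulr2n mulrn_eq0 /= gt_eqF.
split=> h theta.
  have /dvdpP[q ->] := h theta.
  by rewrite E !hornerM !hornerXsubC; split; ring.
have [h1 h2] := h theta; rewrite E.
have := @uniq_roots_dvdp _ (kippenhahn_poly A theta) [:: r%:C; - r%:C].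
rewrite !big_cons big_nil mulr1; apply.
  by rewrite /= /root h1 h2 eqxx.
by rewrite uniq_rootsE /= inE rr.
Qed.

(** Schur complement of the block [- l I]. *)
Lemma kippenhahn_block n (X Y : 'M[C]_n) theta (l : C) : l != 0 ->
  (kippenhahn_poly (block_mx 0 X 0 Y) theta).[l] =
  (-1) ^+ n * \det (l *: Re_mx (expi theta *: Y) - (l ^+ 2)%:M
                    + 4^-1 *: (X^t* *m X)).
Proof.
move=> l0; rewrite kippenhahn_horner; set w := expi theta.
pose Z := Re_mx (w *: Y) - l%:M.
have -> : Re_mx (w *: block_mx 0 X 0 Y) - l%:M =
    block_mx (- l%:M) ((w / 2) *: X) ((w^* / 2) *: X^t*) Z.
  rewrite /Re_mx scale_block_mx tr_block_mx map_block_mx add_block_mx.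
  rewrite scale_block_mx (scalar_mx_block n n) opp_block_mx add_block_mx.
  rewrite !scaler0 !trmx0 !map_mx0 !(addr0, add0r) scaler0 sub0r oppr0 !addr0.
  rewrite adjmxZ !scalerA.
  by rewrite ![_ / 2]mulrC.
have h1 : \det (block_mx 1%:M ((w / (2 * l)) *: X) 0 1%:M : 'M_(n + n)) = 1.
  by rewrite det_ublock !det1 mulr1.
rewrite -[LHS]mulr1 -[X in _ * X = _]h1 -det_mulmx mulmx_block !(mulmx0, mulmx1, addr0).
have -> : - l%:M *m ((w / (2 * l)) *: X) + (w / 2) *: X = 0.
  rewrite mulNmx mul_scalar_mx scalerA.
  by rewrite (_ : l * (w / (2 * l)) = w / 2) ?addNr //; field.
rewrite det_lblock -scaleN1r scale_scalar_mx det_scalar exprMn -mulrA; congr (_ * _).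
rewrite -detZ; congr (\det _).
rewrite scalerDr -scalemxAl -scalemxAr addrC /Z scalerBr scale_scalar_mx -expr2.
congr (_ + _); rewrite !scalerA; congr (_ *: _).
have := expi_unit theta; rewrite -/w => hw.
transitivity (4^-1 * (w * w^*)); first by field.
by rewrite hw mulr1.
Qed.

(** The 3x3 determinant arising from the canonical form, expanded as in the
    cofactor formula.  The variables [wb] and [gb] stand for the conjugates of
    [w] and [g]; [u x] and [v x] are the entries above and below the diagonal
    coming from an entry [x] of the block [canonC]. *)
Lemma det_compressed_pencil (F : fieldType) (b c d e f g gb h w wb l : F) :
  (2 : F) != 0 -> w * wb = 1 ->
  b ^+ 2 + c ^+ 2 + d ^+ 2 = 1 -> e ^+ 2 + f ^+ 2 + g * gb + h ^+ 2 = 1 ->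
  c * e + d * f = 0 ->
  let t00 := 4^-1 - l ^+ 2 in let t11 := (b ^+ 2 + c ^+ 2) / 4 - l ^+ 2 in
  let t22 := l * (h * (w + wb) / 2) - l ^+ 2 + e ^+ 2 / 4 in
  let t12 := l * (w * g / 2) + c * e / 4 in
  let t21 := l * (wb * gb / 2) + c * e / 4 in
  let u x := l * (w * x / 2) in let v x := l * (wb * x / 2) in
  t00 * (t11 * t22 - t12 * t21) - u d * (v d * t22 - t12 * v f)
    + u f * (v d * t21 - t11 * v f)
  = - (l ^+ 2) ^+ 3 + 4^-1 * (3 - h ^+ 2) * (l ^+ 2) ^+ 2
    - 16^-1 * (c ^+ 2 + b ^+ 2 + e ^+ 2 + 1 - h ^+ 2) * l ^+ 2
    + 64^-1 * (b ^+ 2 * e ^+ 2)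
    + l * ((w + wb) / 2 * (h * (l ^+ 2) ^+ 2 - 2^-1 * h * l ^+ 2
             + 16^-1 * ((b ^+ 2 + c ^+ 2) * h))
           - 16^-1 * (c * e * ((w * g + wb * gb) / 2))).
Proof.
move=> n2 hw h1 h2 h3 t00 t11 t22 t12 t21 u v.
have n4 : (4 : F) != 0 by rewrite (natrM _ 2 2) mulf_neq0.
have n16 : (16 : F) != 0 by rewrite (natrM _ 4 4) mulf_neq0.
have n64 : (64 : F) != 0 by rewrite (natrM _ 4 16) mulf_neq0.
have e1 : d ^+ 2 = 1 - b ^+ 2 - c ^+ 2 by rewrite -h1; ring.
have e2 : g * gb = 1 - e ^+ 2 - f ^+ 2 - h ^+ 2 by rewrite -h2; ring.
have e3 : d * f = - (c * e) by apply/eqP; rewrite -addr_eq0 addrC h3.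
(* First collect the products controlled by the hypotheses. *)
transitivity (t00 * t11 * t22
   - t00 * ((w * wb) * (g * gb) * l ^+ 2 / 4
            + l * c * e * (w * g + wb * gb) / 8 + c ^+ 2 * e ^+ 2 / 16)
   - (w * wb) * l ^+ 2 / 4 * (t22 * d ^+ 2 + t11 * f ^+ 2)
   + l ^+ 2 * (w * wb) * (d * f) / 4 * (l * (w * g + wb * gb) / 2 + c * e / 2)).
  rewrite /t12 /t21 /u /v.
  have n8 : (8 : F) != 0 by rewrite (natrM _ 2 4) mulf_neq0.
  by field; rewrite n2 n4 n16 n8.
have e4 : f ^+ 2 * (1 - b ^+ 2 - c ^+ 2) = c ^+ 2 * e ^+ 2.
  by rewrite -e1 mulrC -exprMn e3 sqrrN exprMn.
rewrite hw e1 e2 e3 !mul1r.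
(* The remaining occurrence of f ^+ 2 is absorbed by the square of the
   orthogonality relation. *)
transitivity (- (l ^+ 2) ^+ 3 + 4^-1 * (3 - h ^+ 2) * (l ^+ 2) ^+ 2
    - 16^-1 * (c ^+ 2 + b ^+ 2 + e ^+ 2 + 1 - h ^+ 2) * l ^+ 2
    + 64^-1 * (b ^+ 2 * e ^+ 2)
    + l * ((w + wb) / 2 * (h * (l ^+ 2) ^+ 2 - 2^-1 * h * l ^+ 2
             + 16^-1 * ((b ^+ 2 + c ^+ 2) * h))
           - 16^-1 * (c * e * ((w * g + wb * gb) / 2)))
    + l ^+ 2 / 16 * (f ^+ 2 * (1 - b ^+ 2 - c ^+ 2) - c ^+ 2 * e ^+ 2)).
  rewrite /t00 /t11 /t22.
  by field; rewrite n2 n4 n16 n64 (natrM _ 2 4) mulf_neq0.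
by rewrite e4 subrr mulr0 addr0.
Qed.

Lemma kippenhahn_canon_mx (b c d e f h : R) (g : C) (theta : R) (l : C) :
  l != 0 -> gram_eqs b%:C c%:C d%:C e%:C f%:C g h%:C ->
  let w := expi theta in
  (kippenhahn_poly (canon_mx b%:C c%:C d%:C e%:C f%:C g h%:C) theta).[l] =
  (l ^+ 2) ^+ 3 - 4^-1 * (3 - h%:C ^+ 2) * (l ^+ 2) ^+ 2
    + 16^-1 * (c%:C ^+ 2 + b%:C ^+ 2 + e%:C ^+ 2 + 1 - h%:C ^+ 2) * l ^+ 2
    - 64^-1 * (b%:C ^+ 2 * e%:C ^+ 2)
    - l * ((w + w^*) / 2 * (h%:C * (l ^+ 2) ^+ 2 - 2^-1 * h%:C * l ^+ 2
             + 16^-1 * ((b%:C ^+ 2 + c%:C ^+ 2) * h%:C))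
           - 16^-1 * (c%:C * e%:C * ((w * g + w^* * g^*) / 2))).
Proof.
move=> l0 [] h1 h2 h3 w; rewrite !conjC_real in h1 h2 h3.
rewrite (@kippenhahn_block 3) // -/w.
set B := canonB _ _ _; set Y := canonC _ _ _ _.
set T := _ + 4^-1 *: _.
have TE i j : T i j = l * (2^-1 * (w * Y i j + w^* * (Y j i)^*))
     - l ^+ 2 *+ (i == j) + 4^-1 * \sum_k (B k i)^* * B k j.
  rewrite !mxE; congr (_ * (_ * (_ + _)) - _ + _ * _); rewrite ?rmorphM //.
  by apply: eq_bigr => k _; rewrite !mxE.
have n2 : (2 : C) != 0 by rewrite pnatr_eq0.
have := @det_compressed_pencil _ b%:C c%:C d%:C e%:C f%:C g g^* h%:C w w^* l n2
  (expi_unit theta).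
have {}h1 : b%:C ^+ 2 + c%:C ^+ 2 + d%:C ^+ 2 = 1 by rewrite !expr2.
have {}h2 : e%:C ^+ 2 + f%:C ^+ 2 + g * g^* + h%:C ^+ 2 = 1.
  by rewrite !expr2 (mulrC g).
move=> /(_ h1 h2 h3) /= hdet.
rewrite det_mx33 !TE !big_ord_recl !big_ord0 !mxE /= !inordK //= -!val_eqE /= !inordK //=.
rewrite ?(conjC0, conjC1, conjC_real).
set S := (X in X = _) in hdet; transitivity (- S); first by rewrite /S; field.
by rewrite hdet; ring.
Qed.

End Kippenhahn.

(** * Circles centered at the origin *)

Section Circles.
Variable R : realType.
Local Notation C := R[i].

Lemma kippenhahn_canon_mx_real (b c d e f h : R) (g : C) (theta l : R) :
  l != 0 -> gram_eqs b%:C c%:C d%:C e%:C f%:C g h%:C ->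
  (kippenhahn_poly (canon_mx b%:C c%:C d%:C e%:C f%:C g h%:C) theta).[l%:C] =
  (q_fun b c e h (l ^+ 2)
   - l * (cos theta * p_fun b c e (complex.Re g) h (l ^+ 2)
          + 16^-1 * (c * e * complex.Im g * sin theta)))%:C.
Proof.
move=> l0 hG; rewrite kippenhahn_canon_mx ?fmorph_eq0 //.
have -> : (expi theta + (expi theta)^*) / 2 = (cos theta)%:C.
  apply: (@mulIf _ 2); first by rewrite pnatr_eq0.
  rewrite divfK ?pnatr_eq0 // expi_conj mulr_natr mulr2n.
  by apply/eqP; rewrite eq_complex /= subrr addr0 !eqxx.
have -> : (expi theta * g + (expi theta)^* * g^*) / 2 =
    (cos theta * complex.Re g - sin theta * complex.Im g)%:C.
  apply: (@mulIf _ 2); first by rewrite pnatr_eq0.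
  rewrite divfK ?pnatr_eq0 // expi_conj mulr_natr mulr2n; case: g {hG} => x y.
  by apply/eqP; rewrite eq_complex /=; apply/andP; split; apply/eqP => /=; ring.
by rewrite /q_fun /p_fun; field.
Qed.

(** The values [theta = 0] and [theta = pi / 2] already give the necessity. *)
Lemma contains_circle0_canon_mx (b c d e f h : R) (g : C) (r : R) :
  0 < r -> gram_eqs b%:C c%:C d%:C e%:C f%:C g h%:C ->
  contains_circle0 (canon_mx b%:C c%:C d%:C e%:C f%:C g h%:C) r <->
  [/\ p_fun b c e (complex.Re g) h (r ^+ 2) = 0, q_fun b c e h (r ^+ 2) = 0 &
      c * e * complex.Im g = 0].
Proof.
move=> r0 hG; have rn0 : r != 0 by rewrite gt_eqF.
have E l theta : l != 0 -> _ := fun hl => kippenhahn_canon_mx_real theta hl hG.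
rewrite contains_circle0P //; split=> [h1|[h1 h2 h3] theta]; last first.
  rewrite -rmorphN /= !E ?oppr_eq0 // !sqrrN h1 h2 h3.
  by split; rewrite !(mulr0, mul0r, addr0, subr0).
have {}h1 theta : q_fun b c e h (r ^+ 2) = 0 /\
   (cos theta * p_fun b c e (complex.Re g) h (r ^+ 2)
          + 16^-1 * (c * e * complex.Im g * sin theta)) = 0.
  have [] := h1 theta; rewrite -rmorphN /= !E ?oppr_eq0 // !sqrrN.
  move=> /complexI e1 /complexI e2.
  have hq : q_fun b c e h (r ^+ 2) = 0 by lra.
  split=> //; move/eqP: e1; rewrite hq sub0r oppr_eq0 mulf_eq0 (negPf rn0).
  by move/eqP.
have [hq] := h1 0; rewrite cos0 sin0 !mulr0 addr0 mul1r => hp.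
have [_] := h1 (pi / 2); rewrite hp cos_pihalf sin_pihalf mul0r add0r mulr1.
by move=> hi; split=> //; lra.
Qed.

Lemma gram_eqs_real (b c d e f h : R) (g : C) :
  gram_eqs b%:C c%:C d%:C e%:C f%:C g h%:C ->
  [/\ b ^+ 2 <= 1, e ^+ 2 <= 1 & h ^+ 2 <= 1].
Proof.
case: g => x y [h1 h2 _]; rewrite !conjC_real in h1 h2.
have {}h1 : b ^+ 2 + c ^+ 2 + d ^+ 2 = 1.
  by apply: (@complexI R); rewrite rmorph1 -h1; ring.
have {}h2 : e ^+ 2 + f ^+ 2 + (x ^+ 2 + y ^+ 2) + h ^+ 2 = 1.
  apply: (@complexI R); rewrite rmorph1 -h2; apply/eqP; rewrite eq_complex /=.
  by apply/andP; split; apply/eqP => /=; ring.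
have := sqr_ge0 b; have := sqr_ge0 c; have := sqr_ge0 d; have := sqr_ge0 e.
have := sqr_ge0 f; have := sqr_ge0 x; have := sqr_ge0 y; have := sqr_ge0 h.
by split; lra.
Qed.

Lemma q_fun_gt0 (b c e h rho : R) :
  b ^+ 2 <= 1 -> e ^+ 2 <= 1 -> h ^+ 2 <= 1 -> 1 <= rho ->
  0 < q_fun b c e h rho.
Proof.
move=> hb he hh hr; rewrite /q_fun.
have b0 := sqr_ge0 b; have c0 := sqr_ge0 c; have e0 := sqr_ge0 e; have h0 := sqr_ge0 h.
have hbe : b ^+ 2 * e ^+ 2 <= 1 by rewrite mulr_ile1.
have hr2 : 1 <= rho ^+ 2 by rewrite expr_ge1 //; lra.
have e1 : rho ^+ 2 <= rho ^+ 3 by rewrite [leRHS]exprS ler_peMl // ; lra.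
have e2 : 0 <= h ^+ 2 * rho ^+ 2 by rewrite mulr_ge0 //; lra.
have e3 : 0 <= (c ^+ 2 + b ^+ 2 + e ^+ 2 + 1 - h ^+ 2) * rho by rewrite mulr_ge0 //; lra.
by lra.
Qed.

End Circles.

(** * The center of a circle is a double eigenvalue *)

Lemma char_poly_horner (F : comNzRingType) n (M : 'M[F]_n) (x : F) :
  (char_poly M).[x] = \det (x%:M - M).
Proof.
rewrite /char_poly -horner_evalE -det_map_mx; congr (\det _).
apply/matrixP => i j; rewrite !mxE rmorphB rmorphMn /= /horner_eval hornerC.
by rewrite hornerX.
Qed.

Lemma char_poly_shift (F : comNzRingType) n (A : 'M[F]_n) (a : F) :
  char_poly (A - a%:M) \Po ('X - a%:P) = char_poly A.
Proof.
rewrite /char_poly -[LHS]/(comp_poly ('X - a%:P) _) -det_map_mx; congr (\det _).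
apply/matrixP => i j; rewrite !mxE rmorphB rmorphMn /= comp_polyX comp_polyC.
rewrite polyCB polyCMn mulrnBl; ring.
Qed.

Section Center.
Variable R : realType.
Local Notation C := R[i].

(** A polynomial vanishing on the unit circle is zero; the points of argument
    [- 1 / (k + 1)] are infinitely many. *)
Lemma poly_unit_circle_eq0 (p : {poly C}) :
  (forall theta : R, p.[(expi theta)^*] = 0) -> p = 0.
Proof.
move=> hp; apply/eqP; apply: contraT => p0.
pose rs := [seq (expi (k.+1%:R^-1 : R))^* | k <- iota 0 (size p)].
have := @max_poly_roots _ p rs p0; rewrite size_map size_iota ltnn; apply.
  by apply/allP => x /mapP[k _ ->]; rewrite /root hp.
rewrite map_inj_uniq ?iota_uniq // => k l.
move=> /(can_inj (@conjCK _)) /(congr1 (@complex.Re _)) /=.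
have in0pi m : (m.+1%:R^-1 : R) \in `[0, pi].
  rewrite in_itv /= invr_ge0 ler0n /=.
  apply: (@le_trans _ _ 1); first by rewrite invf_le1 ?ltr0n // ler1n.
  by apply: le_trans (pi_ge2 R); rewrite ler1n.
by move=> /cos_inj -/(_ (in0pi k) (in0pi l)) /invr_inj /eqP; rewrite eqr_nat => /eqP[].
Qed.

(** The conjugate of [e^{i theta}] is replaced with an indeterminate, which is
    then specialized to 0. *)
Lemma circle_center n (A : 'M[C]_n) (a : C) (r : R) :
  0 < r -> contains_circle A a r -> ('X - a%:P) ^+ 2 %| char_poly A.
Proof.
move=> r0 /(contains_circle0P _ r0); set B := A - a%:M => hB.
pose M : 'M[{poly C}]_n := map_mx polyC B + 'X^2 *: map_mx polyC (B^t* ).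
have hroot (s : R) : (forall theta, (kippenhahn_poly B theta).[s%:C] = 0) ->
    root (char_poly M) ((2 * s%:C) *: 'X).
  move=> hs; rewrite /root char_poly_horner; apply/eqP.
  apply: poly_unit_circle_eq0 => theta; set z := (expi theta)^*.
  rewrite -horner_evalE -det_map_mx.
  have -> : map_mx (horner_eval z) (((2 * s%:C) *: 'X)%:M - M) =
      (- (2 * z)) *: (Re_mx (expi theta *: B) - s%:C%:M).
    apply/matrixP => i j; rewrite !mxE rmorphB rmorphMn rmorphD rmorphM /=.
    rewrite /horner_eval !hornerZ !hornerC hornerXn hornerX rmorphM /= -/z.
    have hz : z * expi theta = 1 by rewrite mulrC expi_unit.
    set x := A i j - _; set y := (A j i - _)^*.
    transitivity (2 * s%:C * z *+ (i == j) - ((z * expi theta) * x + z ^+ 2 * y)).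
      by rewrite hz mul1r.
    by case: (i == j); rewrite ?(mulr1n, mulr0n); field.
  by rewrite detZ -kippenhahn_horner hs mulr0.
have h1 : root (char_poly M) ((2 * r%:C) *: 'X).
  by apply: hroot => theta; have [] := hB theta.
have h2 : root (char_poly M) ((2 * (- r)%:C) *: 'X).
  by apply: hroot => theta; have [] := hB theta; rewrite rmorphN.
have [q hq] := factor_theorem _ _ h1.
have hneq : ((2 * (- r)%:C) *: 'X - (2 * r%:C) *: 'X : {poly C}) != 0.
  rewrite -scalerBl scaler_eq0 polyX_eq0 orbF -mulrBr mulf_eq0 pnatr_eq0 /=.
  by rewrite -rmorphB fmorph_eq0 -opprD oppr_eq0 -mulr2n mulrn_eq0 /= gt_eqF.
have : root q ((2 * (- r)%:C) *: 'X).
  move: h2; rewrite hq rootM root_XsubC -subr_eq0 (negPf hneq) orbF //.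
case/factor_theorem => q' hq'.
have hBM : char_poly B = map_poly (horner_eval 0) (char_poly M).
  rewrite map_char_poly; congr char_poly; apply/matrixP => i j.
  rewrite !mxE rmorphD rmorphM /= /horner_eval !hornerC hornerXn.
  by rewrite expr0n /= mul0r addr0.
rewrite -(char_poly_shift A a) -/B hBM hq hq' !rmorphM /=.
have e (x : C) : map_poly (horner_eval 0) ('X - (x *: 'X)%:P) = 'X.
  by rewrite rmorphB /= map_polyX map_polyC /= /horner_eval hornerZ hornerX mulr0 subr0.
by rewrite !e comp_polyX -mulrA -expr2 dvdp_mull.
Qed.

Lemma defect_circle_center (A : 'M[C]_6) (a : C) (r : R) :
  \rank A = 3%N -> (2 <= defect A)%N -> 0 < r -> contains_circle A a r -> a = 0.
Proof.
move=> rA hd r0 /(circle_center r0); have [h ->] := char_poly_defect rA hd.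
move=> hdvd; apply/eqP; apply: contraT => a0.
move: hdvd; rewrite Gauss_dvdpr; last first.
  by rewrite coprimep_expl // coprimep_expr // coprimepX root_XsubC eq_sym.
move=> /dvdp_leq; rewrite polyXsubC_eq0 => /(_ isT).
by rewrite size_XsubC size_exp_XsubC.
Qed.

End Center.

(** * Circular equivalence and conclusion *)

Section Main.
Variable R : realType.
Local Notation C := R[i].

Lemma expiD (s t : R) : expi (s + t) = expi s * expi t.
Proof.
by apply/eqP; rewrite /expi cosD sinD eq_complex /= eqxx /= addrC.
Qed.

(** A rotation of the matrix by [alpha] shifts the angle. *)
Lemma kippenhahn_circ n (A U : 'M[C]_n) (alpha theta : R) (l : C) :
  U \is unitarymx ->
  (kippenhahn_poly (expi alpha *: (U *m A *m U^t*)) theta).[l] =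
  (kippenhahn_poly A (theta + alpha)).[l].
Proof.
move=> hU.
apply: etrans (kippenhahn_horner _ _ _) (etrans _ (esym (kippenhahn_horner _ _ _))).
rewrite (scalerA (expi theta)) -expiD; set w := expi _.
have -> : Re_mx (w *: (U *m A *m U^t*)) - l%:M =
    U *m (Re_mx (w *: A) - l%:M) *m U^t*.
  rewrite mulmxBr mulmxBl scalar_mxC -(mulmxA l%:M) (unitarymxP hU) mulmx1.
  rewrite /Re_mx -scalemxAr -scalemxAl mulmxDr mulmxDl !adjmxZ !adjmx_mul trmxCK.
  by rewrite -!scalemxAr -!scalemxAl !mulmxA.
by rewrite !det_mulmx mulrAC -det_mulmx (unitarymxP hU) det1 mul1r.
Qed.

Lemma circ_equiv_circle0 n (A B : 'M[C]_n) (r : R) :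
  circ_equiv A B -> 0 < r -> contains_circle0 A r <-> contains_circle0 B r.
Proof.
move=> [U [alpha [hU ->]]] r0.
split=> /(contains_circle0P _ r0) h; apply/(contains_circle0P _ r0) => theta.
  have [h1 h2] := h (theta + alpha).
  by split; apply: etrans (kippenhahn_circ _ _ _ _ hU) _.
have [h1 h2] := h (theta - alpha); rewrite -[theta](subrK alpha).
by split; apply: etrans (esym (kippenhahn_circ _ _ _ _ hU)) _.
Qed.

Lemma M_mxE (b c d e f g h : R) :
  M_mx b c d e f g h = canon_mx b%:C c%:C d%:C e%:C f%:C g%:C h%:C.
Proof.
apply/matrixP => i j; rewrite [LHS]mxE /canon_mx.
case: (@split_ordP 3 3 i) => i' ->; case: (@split_ordP 3 3 j) => j' ->;
  rewrite ?(@block_mxEul _ 3 3 3 3) ?(@block_mxEur _ 3 3 3 3)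
    ?(@block_mxEdl _ 3 3 3 3) ?(@block_mxEdr _ 3 3 3 3) mxE;
  by case: (ord3P i') => ->; case: (ord3P j') => ->; rewrite /= ?inordK.
Qed.

Lemma circle0_canonical (A : 'M[C]_6) (b c d e f h : R) (g : C) (r : R) :
  partial_isometry A -> \rank A = 3%N ->
  circ_equiv A (canon_mx b%:C c%:C d%:C e%:C f%:C g h%:C) -> 0 < r ->
  contains_circle0 A r <->
  pq_solution b c e (complex.Re g) h (r ^+ 2) /\ c * e * complex.Im g = 0.
Proof.
move=> hA rA hN r0; rewrite (circ_equiv_circle0 hN r0).
have [U [theta [hU hE]]] := hN.
have hG := canon_mx_gram (circ_equiv_gram hA rA hU (esym hE)).
rewrite (contains_circle0_canon_mx r0 hG).
have [hb he hh] := gram_eqs_real hG.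
split=> [[h1 h2 h3]|[[_ _ h1 h2] h3]] //; split=> //; split=> //.
  by rewrite exprn_gt0.
rewrite ltNge; apply/negP => /(q_fun_gt0 c hb he hh).
by rewrite h2 ltxx.
Qed.

(** All circles contained in the Kippenhahn curve, read off from any canonical
    form. *)
Lemma circles_of_M_mx (A : 'M[C]_6) (b c d e f g h : R) (a : C) (r : R) :
  partial_isometry A -> \rank A = 3%N -> (2 <= defect A)%N ->
  circ_equiv A (M_mx b c d e f g h) -> 0 < r ->
  contains_circle A a r <->
  a = 0 /\ exists2 rho : R, pq_solution b c e g h rho & r = Num.sqrt rho.
Proof.
move=> hA rA hd; rewrite M_mxE => hM r0.
have E : contains_circle A 0 r <-> pq_solution b c e g h (r ^+ 2).
  rewrite /contains_circle raddf0 subr0 (circle0_canonical hA rA hM r0) mulr0.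
  by split=> [[]|].
split=> [hc|[-> [rho hrho rE]]].
  have a0 := defect_circle_center rA hd r0 hc.
  split=> //; exists (r ^+ 2); first by apply/E; rewrite -a0.
  by rewrite sqrtr_sqr gtr0_norm.
by apply/E; rewrite rE sqr_sqrtr //; case: hrho => /ltW.
Qed.

End Main.

Theorem theorem5p7 (R : realType) (A : 'M[R[i]]_6)
    (hA : partial_isometry A) (hrank : \rank A = 3%N)
    (hdef : (2 <= defect A)%N) :
  ((exists (a : R[i]) (r : R), 0 < r /\ contains_circle A a r) <->
   (exists b c d e f g h : R,
      [/\ M_params b c d e f g h,
          circ_equiv A (M_mx b c d e f g h)
        & exists rho : R, pq_solution b c e g h rho]))
  /\
  (forall b c d e f g h : R,
     M_params b c d e f g h ->
     circ_equiv A (M_mx b c d e f g h) ->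
     (exists rho : R, pq_solution b c e g h rho) ->
     forall (a : R[i]) (r : R), 0 < r ->
       (contains_circle A a r <->
        a = 0 /\ exists2 rho : R, pq_solution b c e g h rho & r = Num.sqrt rho)).
Proof.
split; last first.
  move=> b c d e f g h _ hM _ a r r0.
  exact: (circles_of_M_mx a hA hrank hdef hM r0).
split=> [[a [r [r0 hc]]]|[b [c [d [e [f [g [h [_ hM [rho hrho]]]]]]]]]].
  have a0 := defect_circle_center hrank hdef r0 hc.
  move: hc; rewrite a0 /contains_circle raddf0 subr0.
  have [b [c [d [e [f [h [g [hp hN hg]]]]]]]] := canonical_form hA hrank hdef.
  move=> /(circle0_canonical hA hrank hN r0) [hpq him].
  (* g is real: by the choice of phases if c = 0, otherwise because of the
     circle. *)
  have [g' gE] : exists g' : R, g = g'%:C.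
    have [/hg//|c0] := eqVneq c 0; exists (complex.Re g).
    have e0 : e != 0 by apply: contra_neq c0; case: (hp 0).
    move/eqP: him; rewrite !mulf_eq0 (negPf c0) (negPf e0) /= => /eqP.
    by case: (g) => x y /= ->.
  rewrite gE /= in hN hpq; rewrite -M_mxE in hN.
  by exists b, c, d, e, f, g', h; split=> //; exists (r ^+ 2).
have s0 : 0 < Num.sqrt rho by rewrite sqrtr_gt0; case: hrho.
exists 0, (Num.sqrt rho); split=> //.
by apply/(circles_of_M_mx _ hA hrank hdef hM s0); split=> //; exists rho.
Qed.
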